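(* Let $G$ be a simple connected graph with order $n(G)\ge 3$ and let $e$ be a bridge of $G$. Then $$W(G.e) - \varepsilon(G.e) \le W(G) - \varepsilon(G),$$ where $G.e$ is the graph obtained from $G$ by contracting the edge $e$.
   Context: All graphs are finite, simple and connected. $n(G)$ denotes the number of vertices of $G$. $d_G(u,v)$ is the number of edges on a shortest $u,v$-path. The Wiener index is $W(G)=\sum_{\{u,v\}\subseteq V(G)} d_G(u,v)$ (sum over unordered pairs of vertices). The eccentricity of a vertex $v$ is $\varepsilon_G(v)=\max_{u\in V(G)} d_G(v,u)$, and the eccentricity of the graph is $\varepsilon(G)=\sum_{v\in V(G)}\varepsilon_G(v)$. A bridge is an edge whose removal disconnects the graph. Contracting $e=uv$ means deleting $e$ and identifying its end-vertices $u$ and $v$ into one vertex. *)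

(* Defs.v *)
From HB Require Import structures.
From mathcomp Require Import all_boot all_order all_algebra.

Set Implicit Arguments.
Unset Strict Implicit.
Unset Printing Implicit Defensive.

Record sgraph := SGraph {
  vertex :> finType;
  adj : rel vertex;
  adj_sym : symmetric adj;
  adj_irrefl : irreflexive adj
}.

Definition connected (G : sgraph) : bool :=
  [forall x : G, forall y : G, connect (@adj G) x y].

(* A path x :: p has size p edges. *)
Definition has_walk (G : sgraph) (x y : G) (k : nat) : bool :=
  [exists p : k.-tuple G, path (@adj G) x p && (last x p == y)].

(* Least number of edges of a walk from x to y. When y is reachable from x
   some such walk has fewer than #|G| edges; the value is #|G| otherwise. *)
Definition dist (G : sgraph) (x y : G) : nat :=
  find (has_walk x y) (iota 0 #|G|).

(* The enum_rank condition selects each unordered pair of distinct vertices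
   exactly once. *)
Definition wiener (G : sgraph) : nat :=
  \sum_(p : G * G | enum_rank p.1 < enum_rank p.2) dist p.1 p.2.

Definition ecc (G : sgraph) (v : G) : nat := \max_(u : G) dist v u.

Definition total_ecc (G : sgraph) : nat := \sum_(v : G) ecc v.

Section EdgeOperations.
Variables (G : sgraph) (u v : G).

Definition del_edge_adj : rel G :=
  fun x y => adj x y && ([set x; y] != [set u; v]).

Lemma del_edge_sym : symmetric del_edge_adj.
Proof. by move=> x y; rewrite /del_edge_adj adj_sym setUC. Qed.

Lemma del_edge_irrefl : irreflexive del_edge_adj.
Proof. by move=> x; rewrite /del_edge_adj adj_irrefl. Qed.

Definition del_edge : sgraph := SGraph del_edge_sym del_edge_irrefl.

Definition bridge : bool := adj u v && ~~ connected del_edge.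

(* Contraction of uv (with u != v): the vertex obtained by identifying u and v
   is represented by u, so the vertices are those of G other than v. The
   condition a != b discards the loop coming from uv itself. *)
Definition merge_vertex (x : G) : G := if x == v then u else x.

Definition contract_adj : rel {x : G | x != v} :=
  fun a b => (a != b) &&
    [exists x : G, exists y : G,
      [&& adj x y, merge_vertex x == val a & merge_vertex y == val b]].

Lemma contract_sym : symmetric contract_adj.
Proof.
suff H a b : contract_adj a b -> contract_adj b a.
  by move=> a b; apply/idP/idP; exact: H.
case/andP=> nab /existsP[x /existsP[y /and3P[xy xa yb]]].
apply/andP; split; first by rewrite eq_sym.
by apply/existsP; exists y; apply/existsP; exists x; rewrite adj_sym xy yb xa.
Qed.

Lemma contract_irrefl : irreflexive contract_adj.
Proof. by move=> a; rewrite /contract_adj eqxx. Qed.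

Definition contract : sgraph := SGraph contract_sym contract_irrefl.

End EdgeOperations.

(* Main.v *)
(** Contracting uv shortens a distance by at most 1, so the eccentricity of every
vertex other than v drops by at most 1. The Wiener index loses all distances
from v, which sum to at least ecc v + n - 2, so only one unit is missing. If v
has a neighbour y other than u, the pair {u, y} supplies it: it is at distance at
least 2 in G because uv is a bridge, and at distance 1 after the contraction. If
v is a leaf, the eccentricity of u does not drop. *)

Require Import Defs.
From mathcomp Require Import all_boot all_order all_algebra.
From mathcomp Require Import zify.

Lemma adj_neq (G : sgraph) (x y : G) : adj x y -> x != y.
Proof. by apply: contraTneq => ->; rewrite adj_irrefl. Qed.

(** * Metric properties of [dist] in a connected graph *)

Section Distance.
Variable G : sgraph.
Hypothesis hconn : connected G.
Implicit Types x y z : G.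

Lemma has_walkP x y k :
  reflect (exists p, [/\ path (@adj G) x p, last x p = y & size p = k])
          (has_walk x y k).
Proof.
apply: (iffP existsP) => [[p /andP[hp /eqP hl]]|[p [hp hl /eqP hs]]].
  by exists p; rewrite size_tuple.
by exists (Tuple hs); rewrite /= hp hl eqxx.
Qed.

Lemma dist_le_walk x y k : has_walk x y k -> dist x y <= k.
Proof.
move=> hw; rewrite /dist; case: (ltnP k #|G|) => hk; last first.
  by apply: leq_trans hk; rewrite -[X in _ <= X](size_iota 0) find_size.
rewrite leqNgt; apply/negP => /(before_find 0).
by rewrite nth_iota // add0n hw.
Qed.

(** Removing repetitions leaves a walk with fewer than [#|G|] edges, so the search succeeds and its
    default value never occurs. *)
Lemma has_walk_dist x y : has_walk x y (dist x y).
Proof.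
have /connectP[p hp ->] : connect (@adj G) x y.
  by move/forallP/(_ x)/forallP: hconn; apply.
case/shortenP: hp => q hq uq _; set z := last x q.
have hs : size (x :: q) <= #|G| by rewrite -(card_uniqP uq) max_card.
have hh : has (has_walk x z) (iota 0 #|G|).
  apply/hasP; exists (size q); first by rewrite mem_iota.
  by apply/has_walkP; exists q.
have := nth_find 0 hh; rewrite nth_iota //.
by rewrite -[X in _ < X](size_iota 0) -has_find.
Qed.

Lemma distxx x : dist x x = 0.
Proof.
by apply/eqP; rewrite -leqn0; apply/dist_le_walk/has_walkP; exists [::].
Qed.

Lemma dist_step x y z : adj y z -> dist x z <= (dist x y).+1.
Proof.
move=> yz; have /has_walkP[p [hp hl hs]] := has_walk_dist x y.
apply/dist_le_walk/has_walkP; exists (rcons p z).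
by rewrite rcons_path hp hl last_rcons size_rcons hs.
Qed.

Lemma dist_adj x y : adj x y -> dist x y <= 1.
Proof. by move/(dist_step x); rewrite distxx. Qed.

(** Induction along a shortest walk. Lower bounds on distances below come from a suitable [f] that
    grows by at most 1 along edges. *)
Lemma lipschitz_dist (f : G -> nat) x y :
  (forall a b, adj a b -> f b <= (f a).+1) -> f y <= f x + dist x y.
Proof.
move=> fL; have /has_walkP[p [hp <- <-]] := has_walk_dist x y.
elim: p x hp => [|z p IH] x /=; first by rewrite addn0.
by case/andP=> /fL xz /IH; lia.
Qed.

Lemma dist_triangle x y z : dist x z <= dist x y + dist y z.
Proof. by apply: lipschitz_dist => a b; apply: dist_step. Qed.

Lemma distC x y : dist x y = dist y x.
Proof.
suff le (a b : G) : dist a b <= dist b a by apply/eqP; rewrite eqn_leq !le.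
rewrite -[X in _ <= X]add0n -(distxx b).
apply: (lipschitz_dist (fun c => dist c b)) => c d cd.
have dc : adj d c by rewrite adj_sym.
by have := dist_triangle d c b; have := dist_adj _ _ dc; lia.
Qed.

Lemma dist_gt0 x y : x != y -> 0 < dist x y.
Proof.
move=> nxy; rewrite lt0n; apply: contraNneq nxy => d0.
have /has_walkP := has_walk_dist x y.
by rewrite d0 => -[[|z p] []] //= _ ->.
Qed.

Lemma dist_gt1 x y : x != y -> ~~ adj x y -> 1 < dist x y.
Proof.
move=> nxy nadj; have := dist_gt0 _ _ nxy.
case E: (dist x y) => [|[|//]] // _.
have /has_walkP := has_walk_dist x y; rewrite E => -[[|z [|t p]] []] //=.
by rewrite andbT => xz zy; rewrite -zy xz in nadj.
Qed.

Lemma ecc_ge x y : dist x y <= ecc x.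
Proof. exact: (leq_bigmax (F := fun y => dist x y)). Qed.

(** Swapping coordinates matches the two halves of the ordered pairs, and the diagonal contributes
    0. *)
Lemma double_wiener : 2 * wiener G = \sum_(x : G) \sum_(y : G) dist x y.
Proof.
rewrite pair_big /= (bigID (fun p : G * G => enum_rank p.1 < enum_rank p.2)) /=.
rewrite mul2n -addnn; congr (_ + _); rewrite /wiener.
rewrite (reindex_inj (h := fun p : G * G => (p.2, p.1))) /=; last first.
  by move=> [a b] [c d] [-> ->].
rewrite big_mkcond [RHS]big_mkcond; apply: eq_bigr => -[x y] _ /=.
case: ltngtP => //= [|/ord_inj/enum_rank_inj ->]; first by rewrite distC.
by rewrite distxx.
Qed.

End Distance.

(** * The contraction as a quotient of [G], and its distances *)

Section Contraction.
Variables (G : sgraph) (u v : G).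
Hypotheses (hconn : connected G) (uv : adj u v).
Let C := contract u v.

Let neq_uv : u != v := adj_neq _ _ _ uv.

(** The default of [insubd] is used exactly at [v], so this is the quotient map. *)
Definition cproj (x : G) : C := insubd (Sub u neq_uv : {x : G | x != v}) x.

Definition crep (a : C) : G := val a.

Lemma crep_cproj x : crep (cproj x) = merge_vertex u v x.
Proof. by rewrite /crep val_insubd /merge_vertex; case: eqP. Qed.

Lemma cproj_end : cproj v = cproj u.
Proof. by apply: val_inj; rewrite !val_insubd eqxx; case: ifP. Qed.

Lemma cproj_crep (a : C) : cproj (crep a) = a.
Proof. exact: valKd. Qed.

Lemma crep_neq (a : C) : crep a != v.
Proof. exact: (valP a). Qed.

Lemma merge_id (x : G) : x != v -> merge_vertex u v x = x.
Proof. by rewrite /merge_vertex => /negPf ->. Qed.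

Lemma merge_end : merge_vertex u v v = u.
Proof. by rewrite /merge_vertex eqxx. Qed.

Lemma adj_cproj x y : adj x y -> cproj x != cproj y -> adj (cproj x) (cproj y).
Proof.
move=> xy ne; apply/andP; split=> //; apply/existsP; exists x.
apply/existsP; exists y.
by apply/and3P; split=> //; rewrite -crep_cproj.
Qed.

Lemma contract_adjP (a b : C) :
  adj a b -> exists x y, [/\ adj x y, merge_vertex u v x = crep a
                           & merge_vertex u v y = crep b].
Proof.
by case/andP=> _ /existsP[x /existsP[y /and3P[xy /eqP xa /eqP yb]]]; exists x, y.
Qed.

Lemma connected_contract : connected C.
Proof.
apply/forallP=> a; apply/forallP=> b; rewrite -(cproj_crep a) -(cproj_crep b).
have /connectP[p hp ->] : connect (@adj G) (crep a) (crep b).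
  by move/forallP/(_ (crep a))/forallP: hconn; apply.
elim: p (crep a) hp => [|z p IH] x /=; first by rewrite connect0.
case/andP=> xz /IH; apply: connect_trans.
case: (eqVneq (cproj x) (cproj z)) => [->|ne]; first exact: connect0.
exact/connect1/adj_cproj.
Qed.

(** The projection sends each edge to an edge or to a single vertex. *)
Lemma dist_cproj_le x y : dist (cproj x) (cproj y) <= dist x y.
Proof.
rewrite -[X in _ <= X]add0n -(distxx C (cproj x)).
apply: (lipschitz_dist _ hconn (fun z => dist (cproj x) (cproj z))) => a b ab.
case: (eqVneq (cproj a) (cproj b)) => [->|ne]; first exact: leqnSn.
exact/(dist_step _ connected_contract)/adj_cproj.
Qed.

Lemma dist_contract_le (a b : C) : dist a b <= dist (crep a) (crep b).
Proof. by rewrite -{1}(cproj_crep a) -{1}(cproj_crep b) dist_cproj_le. Qed.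

(** Distance to the set of ends of the contracted edge; unlike [dist] to one end, it does not change
    under merging. *)
Definition edge_dist (x : G) : nat := minn (dist x u) (dist x v).

Lemma edge_dist_step x y : adj x y -> edge_dist y <= (edge_dist x).+1.
Proof.
move=> xy; rewrite /edge_dist !(distC _ hconn _ u) !(distC _ hconn _ v).
by have := dist_step _ hconn u _ _ xy; have := dist_step _ hconn v _ _ xy; lia.
Qed.

Lemma edge_dist_merge x : edge_dist (merge_vertex u v x) = edge_dist x.
Proof.
rewrite /merge_vertex; case: eqP => // ->.
by rewrite /edge_dist !distxx min0n minn0.
Qed.

Lemma edge_distu : edge_dist u = 0.
Proof. by rewrite /edge_dist distxx min0n. Qed.

(* A shortest walk of the contraction either avoids the merged vertex, and is
   then a walk of G, or runs through it, and then splits into a walk to the edge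
   and a walk from the edge. *)
Lemma min_dist_edge_le (a b : C) :
  minn (dist (crep a) (crep b)) (edge_dist (crep a) + edge_dist (crep b))
    <= dist a b.
Proof.
pose f (c : C) :=
  minn (dist (crep a) (crep c)) (edge_dist (crep a) + edge_dist (crep c)).
suff fL : forall c d : C, adj c d -> f d <= (f c).+1.
  have := lipschitz_dist C connected_contract f a b fL.
  by rewrite {2}/f distxx min0n.
move=> c d /contract_adjP[x [y [xy xc yd]]].
have yx : adj y x by rewrite adj_sym.
have := edge_dist_step _ _ xy; have := edge_dist_step _ _ yx.
rewrite -(edge_dist_merge x) -(edge_dist_merge y) xc yd /f.
set A := crep a.
have tri : edge_dist A <= dist A (crep c) + edge_dist (crep c).
  rewrite /edge_dist.
  have := dist_triangle _ hconn A (crep c) u.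
  by have := dist_triangle _ hconn A (crep c) v; lia.
(* If [c] or [d] is the merged vertex, its [edge_dist] is 0 and [tri] gives the bound. *)
have [cu|cu] := eqVneq (crep c) u.
  by move: tri; rewrite cu edge_distu; lia.
have [du|du] := eqVneq (crep d) u.
  by move: tri; rewrite du edge_distu; lia.
(* Otherwise neither [x] nor [y] is [v], so the edge already joins the representatives in [G]. *)
have xE : x = crep c.
  by move: xc cu; rewrite /merge_vertex; case: ifP => // _ ->; rewrite eqxx.
have yE : y = crep d.
  by move: yd du; rewrite /merge_vertex; case: ifP => // _ ->; rewrite eqxx.
have := dist_step _ hconn A _ _ xy; rewrite xE yE; lia.
Qed.

(** In the minimum bounded by [min_dist_edge_le], a passage through the merged vertex costs at most
    the extra edge [uv], and a direct walk at most one move between [u] and [v]. *)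
Lemma dist_le_cprojS x y : dist x y <= (dist (cproj x) (cproj y)).+1.
Proof.
have := min_dist_edge_le (cproj x) (cproj y).
rewrite !crep_cproj !edge_dist_merge.
have duv := dist_adj _ hconn _ _ uv.
have dvu : dist v u <= 1 by rewrite distC.
have through p q : dist x y <= dist x p + dist p q + dist q y.
  have := dist_triangle _ hconn x p y.
  by have := dist_triangle _ hconn p q y; lia.
have edge : dist x y <= (edge_dist x + edge_dist y).+1.
  rewrite /edge_dist !(distC _ hconn y).
  have := through u u; have := through u v; have := through v u.
  by have := through v v; rewrite !distxx; lia.
suff : dist x y <= (dist (merge_vertex u v x) (merge_vertex u v y)).+1.
  by lia.
(* Two moves never add up: if both vertices are [v], their distance is 0. *)
have [xv|xv] := eqVneq x v; have [yv|yv] := eqVneq y v.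
- by rewrite xv yv distxx.
- rewrite xv merge_end merge_id //.
  by have := dist_triangle _ hconn v u y; lia.
- rewrite yv merge_end merge_id //.
  by have := dist_triangle _ hconn x u v; lia.
- by rewrite !merge_id.
Qed.

(** * Effect of the contraction on eccentricities and on the Wiener index *)

Lemma ecc_le_contractS (a : C) : ecc (crep a) <= (ecc a).+1.
Proof.
apply/bigmax_leqP => y _; apply: leq_trans (dist_le_cprojS _ _) _.
by rewrite ltnS cproj_crep; apply: ecc_ge.
Qed.

Lemma sum_contract (F : G -> nat) :
  \sum_(x : G) F x = F v + \sum_(a : C) F (crep a).
Proof.
rewrite (bigD1 v) //=; congr (_ + _).
rewrite (reindex_omap (val : {x : G | x != v} -> G) insub) /=; last first.
  by move=> x xv; rewrite insubT.
by apply: eq_bigl => a; rewrite valK eqxx (crep_neq a).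
Qed.

(** Split [v] off the double sum; no remaining distance grows under contraction. The pair [a0], [b0]
    keeps its exact loss, which is 0 when [a0 = b0]. *)
Lemma wiener_contract_le (a0 b0 : C) :
  wiener C + \sum_(a : C) dist v (crep a)
    + (dist (crep a0) (crep b0) - dist a0 b0) <= wiener G.
Proof.
rewrite -(leq_pmul2l (m := 2)) // !mulnDr (double_wiener _ hconn).
rewrite (double_wiener _ connected_contract) sum_contract sum_contract distxx.
have -> : \sum_(a : C) \sum_(y : G) dist (crep a) y =
    \sum_(a : C) dist v (crep a)
    + \sum_(a : C) \sum_(b : C) dist (crep a) (crep b).
  rewrite -big_split; apply: eq_bigr => a _ /=.
  by rewrite sum_contract distC.
suff : \sum_(a : C) \sum_(b : C) dist a b
    + 2 * (dist (crep a0) (crep b0) - dist a0 b0)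
    <= \sum_(a : C) \sum_(b : C) dist (crep a) (crep b) by lia.
have [->|ab] := eqVneq a0 b0.
  rewrite distxx addn0; apply: leq_sum => a _; apply: leq_sum => b _.
  exact: dist_contract_le.
rewrite !pair_big /=.
(* The doubled sum contains the chosen pair in both orders; both are isolated. *)
have ne : (b0, a0) != (a0, b0) by rewrite xpair_eqE eq_sym (negPf ab).
rewrite !(bigD1 (a0, b0) (P := xpredT)) //=.
rewrite !(bigD1 (b0, a0) (P := fun p => p != (a0, b0))) //=.
rewrite (distC _ connected_contract b0) (distC _ hconn (crep b0)).
have := dist_contract_le a0 b0.
set S := (X in _ -> dist a0 b0 + (dist a0 b0 + X) + _ <= _).
set T := (X in _ -> _ <= _ + (_ + X)).
suff : S <= T by lia.
by apply: leq_sum => p _; apply: dist_contract_le.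
Qed.

(** A vertex farthest from [v] contributes [ecc v], and each of the other [#|C| - 1] vertices at
    least 1. *)
Lemma ecc_add_card_le : ecc v + #|C| <= (\sum_(a : C) dist v (crep a)).+1.
Proof.
have dvu : 0 < ecc v.
  by apply: leq_trans (ecc_ge _ v u); rewrite dist_gt0 // eq_sym.
have [y ey] : {y | ecc v = dist v y}.
  by apply: eq_bigmax; apply/card_gt0P; exists v.
have yv : y != v by apply: contraTneq dvu => yv; rewrite ey yv distxx.
pose b : C := Sub y yv.
rewrite (bigD1 b) //= -ey -cardsT (cardsD1 b) in_setT add1n addnS ltnS leq_add2l.
rewrite -sum1_card (eq_bigl (fun a => a != b)); last first.
  by move=> a; rewrite !inE andbT.
by apply: leq_sum => a _; rewrite dist_gt0 // eq_sym (crep_neq a).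
Qed.

(** Each vertex of [C] accounts for a loss of at most 1, together [#|C|]; the slack at [b0] is
    retained. *)
Lemma total_ecc_contract_le (b0 : C) :
  total_ecc G + ((ecc b0).+1 - ecc (crep b0)) <= total_ecc C + ecc v + #|C|.
Proof.
rewrite /total_ecc sum_contract -addnA addnC -[leqRHS]addnA.
rewrite (addnC (ecc v)) addnA leq_add2r -sum1_card -big_split /=.
rewrite (bigD1 b0) // [leqRHS](bigD1 b0) //= addnAC leq_add ?leq_sum //.
  by rewrite subnKC ?addn1 ?ecc_le_contractS.
by move=> a _; rewrite addn1 ecc_le_contractS.
Qed.

Lemma crep_cproj_u : crep (cproj u) = u.
Proof. by rewrite crep_cproj merge_id. Qed.

(** When [v] is a leaf, its only edge becomes a loop, so the contraction creates no shortcut from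
    [u] to the vertices other than [v]. *)
Lemma ecc_contract_leaf :
  2 < #|G| -> (forall y, adj v y -> y = u) -> ecc u <= ecc (cproj u).
Proof.
move=> hn leaf; apply/bigmax_leqP => y _.
have [->|yv] := eqVneq y v.
  apply: leq_trans (dist_adj _ hconn _ _ uv) _.
  (* A third vertex makes the eccentricity of the merged vertex at least 1, which covers the
     distance from [u] to [v]. *)
  have /card_gt0P[w] : 0 < #|~: [set u; v]|.
    by rewrite cardsCs setCK cards2 neq_uv subn_gt0.
  rewrite !inE negb_or => /andP[wu wv].
  apply: leq_trans (ecc_ge _ _ (cproj w)).
  rewrite dist_gt0 ?connected_contract //.
  apply: contra_neq wu => /(congr1 crep).
  by rewrite crep_cproj_u crep_cproj merge_id.
apply: leq_trans (ecc_ge _ _ (cproj y)).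
have /= := lipschitz_dist _ connected_contract (fun a => dist u (crep a))
  (cproj u) (cproj y).
rewrite crep_cproj_u crep_cproj merge_id // distxx add0n; apply=> a b.
move=> ab; have [x [z [xz xa zb]]] := contract_adjP _ _ ab.
have nab : merge_vertex u v x != merge_vertex u v z.
  by rewrite xa zb; apply: contraNneq (adj_neq C a b ab) => /val_inj ->.
(* An edge at the leaf [v] ends in [u], and both ends would merge. *)
have xv : x != v.
  apply: contraNneq nab => E; rewrite E in xz *.
  by rewrite (leaf _ xz) merge_end merge_id.
have zv : z != v.
  apply: contraNneq nab => E; rewrite E adj_sym in xz *.
  by rewrite (leaf _ xz) merge_end merge_id.
by rewrite -xa -zb !merge_id // dist_step.
Qed.

(** A common neighbour [y] of [u] and [v] would give a detour around [uv], so deleting the edge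
    would keep the graph connected. *)
Lemma bridge_nadj (y : G) :
  bridge u v -> adj v y -> y != u -> ~~ adj u y.
Proof.
case/andP=> _ hbr vy yu; apply: contra hbr => uy.
apply/forallP=> a; apply/forallP=> b.
have detour p q : p \in [set u; v] -> q \in [set u; v] ->
    connect (@adj (del_edge u v)) p q.
  have step z : z \in [set u; v] -> adj (z : del_edge u v) y.
    rewrite !inE => zuv; apply/andP; split.
      by case/orP: zuv => /eqP ->.
    apply: contraNneq yu => /setP/(_ y); rewrite !inE eqxx orbT.
    by rewrite (eq_sym y v) (negPf (adj_neq _ _ _ vy)) orbF => /esym.
  move=> /step py /step qy; apply: connect_trans (connect1 py) (connect1 _).
  by rewrite adj_sym.
have sub : subrel (connect (@adj G)) (connect (@adj (del_edge u v))).
  apply: connect_sub => p q pq.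
  have [E|ne] := eqVneq [set p; q] [set u; v]; last by apply/connect1/andP.
  by apply: detour; rewrite -E !inE eqxx ?orbT.
by apply: sub; move/forallP/(_ a)/forallP: hconn; apply.
Qed.

End Contraction.

Theorem theorem4p2 (G : sgraph) (u v : G) (hconn : connected G)
    (hn : 3 <= #|G|) (hbridge : bridge u v) :
  ((wiener (contract u v))%:Z - (total_ecc (contract u v))%:Z
     <= (wiener G)%:Z - (total_ecc G)%:Z)%R.
Proof.
have uv : adj u v by case/andP: hbridge.
have hC := connected_contract _ _ _ hconn uv.
have hsum := ecc_add_card_le _ _ _ hconn uv.
pose c x := cproj _ _ _ uv x.
have hecc := total_ecc_contract_le _ _ _ hconn uv (c u).
have hw x := wiener_contract_le _ _ _ hconn uv (c u) (c x).
rewrite crep_cproj_u in hecc.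
have [/existsP[y /andP[vy yu]]|] := boolP [exists y : G, adj v y && (y != u)].
  have yv : y != v by rewrite eq_sym (adj_neq _ _ _ vy).
  have cuy : adj (c u) (c y).
    (* The merged vertex is also the image of [v], so the edge [vy] projects to the required
       edge. *)
    rewrite /c -cproj_end; apply: adj_cproj vy _.
    apply: contra_neq yu => /(congr1 (crep _ _ _)).
    by rewrite !crep_cproj merge_end merge_id.
  have := hw y; rewrite crep_cproj_u crep_cproj merge_id //.
  have := dist_adj _ hC _ _ cuy.
  have : 1 < dist u y.
    apply: dist_gt1 => //; first by rewrite eq_sym.
    exact: bridge_nadj hbridge vy yu.
  lia.
rewrite negb_exists => /forallP leaf.
have : ecc u <= ecc (c u).
  apply: ecc_contract_leaf => // y vy; apply/eqP.
  by have := leaf y; rewrite vy negbK.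
(* The extra Wiener term is now 0; the missing unit is the slack of [hecc] at [c u]. *)
by have := hw u; lia.
Qed.
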